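(* Let $0<q<1$ and let $\mathcal{H}=\{s_{m+n}\}_{m,n\ge0}$ be the Hankel matrix of the indeterminate Stieltjes problem with moments $s_n=q^{-n^2/2}$, $n\ge0$. The set $\mathcal{V}$ of real sequences $v=(v_n)_{n\ge0}$ such that $\mathcal{H}v=0$ and $\mathcal{H}v$ is absolutely convergent is an infinite dimensional vector space. For any $k\ge1$ and any $(a_0,a_1,\ldots,a_{k-1})\in\mathbb{R}^k$ there exists $v\in\mathcal{V}$ such that $v_j=a_j$ for $j=0,1,\ldots,k-1$.
   Context: ''$\mathcal{H}v$ is absolutely convergent'' means $\sum_{n=0}^\infty|s_{m+n}v_n|<\infty$ for all $m\ge0$, and $\mathcal{H}v=0$ means $\sum_{n=0}^\infty s_{m+n}v_n=0$ for all $m\ge0$. The numbers $s_n=q^{-n^2/2}$ are the moments $\int_0^\infty x^n\frac{w_q(x)}{x}\,dx$ with $w_q(x)=\frac{1}{\sqrt{2\pi\log(1/q)}}\exp\big(-\frac{(\log x)^2}{2\log(1/q)}\big)$. *)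

(* Defs.v *)
From mathcomp Require Import all_boot all_order all_algebra.
From mathcomp Require Import all_classical all_reals all_analysis.

Set Implicit Arguments.
Unset Strict Implicit.
Unset Printing Implicit Defensive.

Import Order.TTheory GRing.Theory Num.Theory.
Import numFieldNormedType.Exports.

Local Open Scope classical_set_scope.
Local Open Scope ring_scope.

Definition hankel (R : realType) (s : R^nat) (m n : nat) : R := s (m + n)%N.

Definition abs_convergent_mul (R : realType) (H : nat -> nat -> R)
    (v : R^nat) : Prop :=
  forall m, (\sum_(0 <= n <oo) `|H m n * v n|%:E < +oo)%E.

Definition mul_eq0 (R : realType) (H : nat -> nat -> R) (v : R^nat) : Prop :=
  forall m, series (fun n => H m n * v n) @ \oo --> (0 : R).

Definition abs_kernel (R : realType) (H : nat -> nat -> R) : set (nat -> R) :=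
  [set v | mul_eq0 H v /\ abs_convergent_mul H v].

(* The closed form q^(-n^2/2) of the moments on (0, +oo) of the log-normal
   density x^-1 (2 pi L)^(-1/2) exp(- (ln x)^2 / (2 L)), where L = ln (1/q). *)
Definition lognormal_moment (R : realType) (q : R) (n : nat) : R :=
  q `^ (- (n%:R ^+ 2 / 2)).

(* No finite family of elements of V spans V; only meaningful when V is a
   linear subspace. *)
Definition infinite_dimensional (R : realType) (E : lmodType R) (V : set E) :
    Prop :=
  ~ exists (d : nat) (e : 'I_d -> E),
      (forall i, V (e i)) /\
      (forall v, V v -> exists c : 'I_d -> R, v = \sum_(i < d) c i *: e i).

(* Main.v *)
(* Since s_(m+n) = s_m s_n q^(-mn), writing v_n = w_n / s_n turns H v = 0 into
   the vanishing at all the points q^(-m), m >= 0, of the power series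
   W(z) = sum_n w_n z^n. The entire function F(z) = (z; q)_oo has these zeros:
   F(z) = (1 - z) F(qz) yields F(1) = 0 and then F(q^(-m)) = 0 by induction on
   m. Hence so does z^k F(z) for every k; as F(0) = 1, these series have leading
   terms in every degree, so the first coefficients of v can be prescribed by
   solving a triangular system. *)
Require Import Defs.
From mathcomp Require Import all_boot all_order all_algebra.
From mathcomp Require Import all_classical all_reals all_analysis.
From mathcomp Require Import ring lra.

Set Implicit Arguments.
Unset Strict Implicit.
Unset Printing Implicit Defensive.

Import Order.TTheory GRing.Theory Num.Theory.
Import numFieldNormedType.Exports.

Local Open Scope classical_set_scope.
Local Open Scope ring_scope.

(** Passes from the extended-real sum in [abs_convergent_mul] to real series, where comparison
    arguments apply. *)
Lemma nneseries_normr_ltyP (R : realType) (u : R^nat) :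
  (\sum_(0 <= n <oo) `|u n|%:E < +oo)%E <-> cvgn [normed series u].
Proof.
split=> [|cu]; first exact: nnseries_is_cvg.
rewrite (_ : limn _ = (limn [normed series u])%:E) ?ltry//.
rewrite -EFin_lim//; congr (limn _); apply/funext => n /=.
by rewrite sumEFin.
Qed.

Lemma normed_seriesZD (R : realType) (a : R) (u v : R^nat) :
  cvgn [normed series u] -> cvgn [normed series v] ->
  cvgn [normed series (a *: u + v)].
Proof.
move=> cu cv.
apply: (@series_le_cvg _ _ (`|a| *: (fun n => `|u n|) + (fun n => `|v n|))) => //.
- by move=> n /=; exact: normr_ge0.
- by move=> n; rewrite !fctE /GRing.scale /= addr_ge0// mulr_ge0.
- move=> n; rewrite !fctE /GRing.scale /=.
  by rewrite (le_trans (ler_normD _ _))// normrM.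
- by apply: is_cvg_seriesD => //; exact: is_cvg_seriesZ.
Qed.

Lemma abs_kernel_submod_closed (R : realType) (H : nat -> nat -> R) :
  submod_closed [in abs_kernel H].
Proof.
have fE m (a : R) (u v : nat -> R) : (fun n => H m n * (a *: u + v) n) =
    a *: (fun n => H m n * u n) + (fun n => H m n * v n).
  by apply/funext => n; rewrite !fctE /GRing.scale /=; ring.
split=> [|a u v]; rewrite !inE.
  split=> m.
    rewrite (_ : series _ = cst 0); first exact: cvg_cst.
    by apply/funext => n; rewrite /series /= big1// => i _; rewrite mulr0.
  rewrite eseries0 ?ltry// => n _ _.
  by rewrite mulr0 normr0.
move=> [u0 cu] [v0 cv]; split=> m.
  rewrite fE seriesD seriesZ.
  rewrite -[X in _ --> X]addr0 -[X in _ --> X + _](scaler0 _ a).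
  by apply: cvgD => //; exact: cvgZl_tmp.
under eq_eseriesr do rewrite (congr1 (fun f => f _) (fE m a u v)).
apply/nneseries_normr_ltyP/normed_seriesZD; exact/nneseries_normr_ltyP.
Qed.

Lemma series_addn (V : zmodType) (u : V^nat) N n :
  series u (n + N)%N = series u N + series (fun i => u (i + N)%N) n.
Proof.
rewrite /series /= (@big_cat_nat _ _ _ N) ?leq_addl//=; congr (_ + _).
by rewrite -{1}[N]add0n big_addn addnK.
Qed.

Lemma cvg_series_shiftn (R : realType) (u : R^nat) N (l : R) :
  series (fun i => u (i + N)%N) @ \oo --> l ->
  series u @ \oo --> series u N + l.
Proof.
move=> ul; rewrite -(cvg_shiftn N).
rewrite (_ : [sequence _]_n = cst (series u N) + series (fun i => u (i + N)%N)).
  by apply: cvgD => //; exact: cvg_cst.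
by apply/funext => n; rewrite /= series_addn.
Qed.

(** From index [N] on, the terms are dominated by the geometric sequence [u N * r ^+ n]. *)
Lemma ratio_test (R : realType) (u : R^nat) (r : R) N :
  (forall n, 0 <= u n) -> 0 <= r < 1 ->
  (forall n, (N <= n)%N -> u n.+1 <= r * u n) -> cvgn (series u).
Proof.
move=> u0 /andP[r0 r1] ur.
suff /cvg_ex[l ul] : cvgn (series (fun i => u (i + N)%N)).
  by apply/cvg_ex; exists (series u N + l); exact: cvg_series_shiftn.
apply: (@series_le_cvg _ _ (geometric (u N) r)) => //= [n|n|].
- by rewrite mulr_ge0// exprn_ge0.
- elim: n => [|n IH]; first by rewrite mulr1.
  rewrite addSn (le_trans (ur _ _)) ?leq_addl//.
  by rewrite exprS mulrCA ler_wpM2l.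
- by apply: is_cvg_geometric_series; rewrite ger0_norm.
Qed.

(* Taylor coefficients of [(z; q)_oo = \prod_(i >= 0) (1 - z q^i)]. *)
Definition euler_coef (R : realType) (q : R) (n : nat) : R :=
  \prod_(0 <= i < n) (- q ^+ i / (1 - q ^+ i.+1)).

Section Euler.
Variables (R : realType) (q : R).
Hypotheses (q0 : 0 < q) (q1 : q < 1).

Local Notation c := (euler_coef q).

Lemma euler_coef0 : c 0%N = 1.
Proof. by rewrite /euler_coef big_geq. Qed.

Lemma euler_coefS n : c n.+1 = - q ^+ n / (1 - q ^+ n.+1) * c n.
Proof. by rewrite /euler_coef big_nat_recr//= mulrC. Qed.

(** This is F(z) = (1 - z) F(qz) read on the coefficients of z^(n+1). *)
Lemma euler_coef_rec n : c n.+1 * (1 - q ^+ n.+1) = - q ^+ n * c n.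
Proof.
by rewrite euler_coefS mulrAC divfK// subr_eq0 gt_eqF// exprn_ilt1// ltW.
Qed.

(** In absolute value each term is at most q^n |x| / (1 - q) times the previous one, and this factor
    tends to 0. So F is defined at every [x], in particular at the unbounded points q^(-m). *)
Lemma normed_cvg_euler_series x : cvgn [normed series (fun n => c n * x ^+ n)].
Proof.
have qx : (fun n => q ^+ n * `|x| / (1 - q)) @ \oo --> (0 : R).
  rewrite -[X in _ --> X](mul0r (`|x| / (1 - q))).
  under eq_fun do rewrite -mulrA.
  by apply: cvgMr_tmp; apply: cvg_expr; rewrite gtr0_norm.
have [N _ HN] : \forall n \near \oo, q ^+ n * `|x| / (1 - q) < 2^-1.
  by apply: (cvgr_lt (0 : R)) => //; rewrite invr_gt0.
apply: (@ratio_test _ _ 2^-1 N) => [n /=||n].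
- exact: normr_ge0.
- by apply/andP; split; lra.
move=> /HN /= Hn.
rewrite euler_coefS (exprS x) !normrM normrN normfV.
rewrite (ger0_norm (exprn_ge0 n (ltW q0))).
have qn : q ^+ n.+1 <= q by rewrite exprS ler_piMr ?exprn_ile1// ltW.
have qn0 : 0 < 1 - q ^+ n.+1 by rewrite subr_gt0 (le_lt_trans qn).
rewrite (gtr0_norm qn0).
rewrite [leLHS](_ : _ = q ^+ n * `|x| / (1 - q ^+ n.+1) * (`|c n| * `|x ^+ n|)); last first.
  by field; rewrite (lt0r_neq0 qn0).
apply: ler_wpM2r; first by rewrite mulr_ge0.
apply/(le_trans _ (ltW Hn))/ler_wpM2l; first by rewrite mulr_ge0// exprn_ge0// ltW.
by rewrite lef_pV2 ?posrE// ?subr_gt0// lerB.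
Qed.

Lemma cvg_euler_series x : cvgn (series (fun n => c n * x ^+ n)).
Proof. exact/normed_cvg/normed_cvg_euler_series. Qed.

Definition euler_fun x : R := limn (series (fun n => c n * x ^+ n)).

Lemma euler_funE x : euler_fun x = (1 - x) * euler_fun (q * x).
Proof.
set F := euler_fun.
have cF y : series (fun n => c n * y ^+ n) @ \oo --> F y by exact: cvg_euler_series.
suff dE : series (fun n => c n * x ^+ n) @ \oo --> F (q * x) - x * F (q * x).
  by rewrite (cvg_unique _ (cF x) dE)// mulrBl mul1r.
(* Multiplication by [x] raises degrees by one: [n.+1] terms at [x] match [n.+1] terms at [q * x]
   minus [x] times only [n] terms. *)
rewrite -(cvg_shiftS _ _).
rewrite (_ : [sequence _]_n =
    (fun n => series (fun n => c n * (q * x) ^+ n) n.+1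
     - x * series (fun n => c n * (q * x) ^+ n) n)); last first.
  apply/funext => n; rewrite /series /= !big_nat_recl//= !expr0 -addrA; congr (_ + _).
  rewrite mulr_sumr -sumrB; apply: eq_bigr => i _.
  have := euler_coef_rec i; rewrite !exprMn !exprS => H.
  have -> : c i.+1 * (x * x ^+ i) =
      (q * q ^+ i * c i.+1 - q ^+ i * c i) * (x * x ^+ i) by congr (_ * _); lra.
  ring.
apply: cvgB; last exact: cvgMl_tmp.
by rewrite (cvg_shiftS (series _)).
Qed.

Lemma euler_fun_root m : euler_fun (q ^- m) = 0.
Proof.
elim: m => [|m IH]; rewrite euler_funE; first by rewrite expr0 invr1 subrr mul0r.
by rewrite exprS invfM mulVKf ?gt_eqF// IH mulr0.
Qed.

End Euler.

(** The factor q^(-mn) is the cross term of (m + n)^2 / 2. *)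
Lemma lognormal_momentD (R : realType) (q : R) (m n : nat) : 0 < q ->
  lognormal_moment q (m + n)%N =
  lognormal_moment q m * lognormal_moment q n * q ^- (m * n)%N.
Proof.
move=> q0.
rewrite /lognormal_moment -powR_mulrn ?ltW// -powRN.
rewrite -!powRD ?(lt0r_neq0 q0) ?implybT//.
by congr powR; rewrite natrD natrM; lra.
Qed.

(** The sequence w_n / s_n, where w_n are the Taylor coefficients of z^k F(z). *)
Definition shifted_euler_kernel (R : realType) (q : R) (k n : nat) : R :=
  if (n < k)%N then 0 else (lognormal_moment q n)^-1 * euler_coef q (n - k).

Lemma abs_kernel_shifted_euler (R : realType) (q : R) k : 0 < q -> q < 1 ->
  abs_kernel (hankel (lognormal_moment q)) (shifted_euler_kernel q k).
Proof.
move=> q0 q1.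
set f := fun m n => hankel (lognormal_moment q) m n * shifted_euler_kernel q k n.
(* Past its [k] initial zeros, row [m] is a constant multiple of the series of F at q^(-m), since
   s_(n+k) cancels. *)
have fS m : (fun n => f m (n + k)%N) = (lognormal_moment q m * q ^- (m * k)%N) *:
    (fun n => euler_coef q n * (q ^- m) ^+ n).
  apply/funext => n; rewrite !fctE /GRing.scale /=.
  rewrite /f /hankel /shifted_euler_kernel ltnNge leq_addl /= addnK.
  have sk : lognormal_moment q (n + k) != 0 by rewrite gt_eqF ?powR_gt0.
  rewrite lognormal_momentD// mulnDr exprD exprVn -exprM; field.
  by rewrite sk !expf_neq0 ?gt_eqF.
have fk m n : (n < k)%N -> f m n = 0.
  by move=> nk; rewrite /f /shifted_euler_kernel nk mulr0.
have series_k (g : R^nat) : (forall n, (n < k)%N -> g n = 0) -> series g k = 0.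
  by move=> g0; rewrite /series /= big_nat big1.
split=> m.
  (* The limit 0 is rewritten as the vanishing sum of the first [k] terms plus the limit 0 of the
     tail. *)
  rewrite -[X in _ --> X]addr0 -{1}(series_k (f m))//; last exact: fk.
  apply: cvg_series_shiftn.
  rewrite (_ : (fun i => _) = fun n => f m (n + k)%N)// fS seriesZ.
  rewrite -[X in _ --> X](scaler0 _ (lognormal_moment q m * q ^- (m * k)%N)).
  apply: cvgZl_tmp; rewrite -(euler_fun_root q0 q1 m).
  exact: cvg_euler_series.
apply/nneseries_normr_ltyP.
have /cvg_ex[l cl] : cvgn (series (fun n => `|f m (n + k)%N|)).
  rewrite (_ : (fun n => _) = `|lognormal_moment q m * q ^- (m * k)%N| *:
      (fun n => `|euler_coef q n * (q ^- m) ^+ n|)).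
    by apply: is_cvg_seriesZ; exact: normed_cvg_euler_series.
  apply/funext => n; rewrite -[RHS]normrM.
  by rewrite (congr1 (fun g => g n) (fS m)).
by apply/cvg_ex; exists (series (fun n => `|f m n|) k + l); exact: cvg_series_shiftn.
Qed.

(** Induction on [k]: a multiple of [e k] corrects coordinate [k], as [e k k] is invertible, and
    leaves the earlier coordinates alone. *)
Lemma prescribe_echelon (R : realType) (V : set (nat -> R))
    (e : nat -> nat -> R) : submod_closed [in V] -> (forall k, V (e k)) ->
  (forall k n, (n < k)%N -> e k n = 0) -> (forall k, e k k != 0) ->
  forall (k : nat) (a : nat -> R),
    exists v, V v /\ forall j, (j < k)%N -> v j = a j.
Proof.
move=> [V0 Vl] Ve e0 e1 k a; elim: k => [|k [v [Vv va]]].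
  by exists 0; split => //; move: V0; rewrite inE.
exists (((a k - v k) / e k k) *: e k + v); split.
  have := Vl ((a k - v k) / e k k) (e k) v.
  by rewrite !inE; apply.
move=> j; rewrite ltnS leq_eqVlt => /predU1P[->|jk]; rewrite !fctE /GRing.scale /=.
  by field; exact: e1.
by rewrite (e0 _ _ jk) mulr0 add0r va.
Qed.

(** If [d] vectors spanned [V], their truncations to [d.+1] coordinates would span every unit
    vector, so a matrix with [d] rows would have rank at least [d.+1]. *)
Lemma infinite_dimensional_prescribe (R : realType) (V : set (nat -> R)) :
  (forall (k : nat) (a : nat -> R),
    exists v, V v /\ forall j, (j < k)%N -> v j = a j) ->
  infinite_dimensional V.
Proof.
move=> Va [d [e [_ eV]]].
pose E : 'M[R]_(d, d.+1) := \matrix_(i, j) e i j.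
suff : (1%:M <= E)%MS.
  by move=> /mxrankS; rewrite mxrank1 => /leq_trans/(_ (rank_leq_row E)); rewrite ltnn.
apply/row_subP => i.
(* [v] begins with row [i] of the identity matrix; its coefficients on [e] express that row through
   the rows of [E]. *)
have [v [Vv va]] := Va d.+1 (fun j => (i == j :> nat)%:R).
have [c vc] := eV v Vv.
apply/submxP; exists (\row_j c j); apply/rowP => j.
rewrite !mxE -(va j)// vc fct_sumE.
by apply: eq_bigr => l _; rewrite !mxE.
Qed.

Theorem theoremA3 (R : realType) (q : R) (q0 : 0 < q) (q1 : q < 1) :
  let V : set (nat -> R) := abs_kernel (hankel (lognormal_moment q)) in
  submod_closed [in V] /\
  infinite_dimensional V /\
  (forall (k : nat) (a : 'I_k -> R), (1 <= k)%N ->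
     exists v : nat -> R, V v /\ forall j : 'I_k, v j = a j).
Proof.
move=> V.
have VS : submod_closed [in V] := abs_kernel_submod_closed _.
have Va : forall (k : nat) (a : nat -> R),
    exists v, V v /\ forall j, (j < k)%N -> v j = a j.
  apply: (@prescribe_echelon _ _ (shifted_euler_kernel q)) => // [k|k n nk|k].
  - exact: abs_kernel_shifted_euler.
  - by rewrite /shifted_euler_kernel nk.
  - rewrite /shifted_euler_kernel ltnn subnn euler_coef0 mulr1.
    by rewrite invr_eq0 gt_eqF ?powR_gt0.
split=> //; split; first exact: infinite_dimensional_prescribe.
case=> // k a _.
(* [inord] extends the tuple to all indices, with default [a ord0] from [k.+1] on; only the indices
   below [k.+1] are read. *)
have [v [Vv va]] := Va k.+1 (fun n => a (inord n)).
by exists v; split=> // j; rewrite va// inord_val.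
Qed.
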